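(* Let $S$ be a stable semigroup with finitely many $\mathscr J$-classes, $J_1,\dots, J_n$, with $J_1$ minimal. For each $r=1,\dots,n$, let $\Gamma_r$ be the Schützenberger group of any $\mathscr H$-class of $J_r$. If $J_2,\dots, J_n$ are all $\mathscr H$-separable then \[ \mathrm{Ht}(\mathrm{Cong}(S))= \mathrm{Ht}(\mathrm{Cong}({}^S J_1^S)) +\sum_{r=2}^n \mathrm{Ht}(\mathrm{NSub}(\Gamma_r)). \]
   Context: The height $\mathrm{Ht}(P)$ of a poset $P$ is the supremum of the cardinalities of chains in $P$. For a semigroup $S$, $S^1$ is $S$ if $S$ is a monoid and otherwise $S$ with an identity adjoined. Green's relations: $x\mathrel{\mathscr L}y\Leftrightarrow S^1x=S^1y$, $x\mathrel{\mathscr R}y\Leftrightarrow xS^1=yS^1$, $x\mathrel{\mathscr J}y\Leftrightarrow S^1xS^1=S^1yS^1$, $\mathscr H=\mathscr L\cap\mathscr R$. The $\mathscr J$-classes are ordered by $J_x\le J_y\Leftrightarrow S^1xS^1\subseteq S^1yS^1$; minimality refers to this order. A $\mathscr J$-class $J$ is stable if for all $x\in J$, $s\in S^1$: $x\mathrel{\mathscr J}sx\Rightarrow x\mathrel{\mathscr L}sx$ and $x\mathrel{\mathscr J}xs\Rightarrow x\mathrel{\mathscr R}xs$; $S$ is stable if all its $\mathscr J$-classes are stable. $\mathrm{Cong}(S)$ is the lattice of (two-sided) congruences of $S$. An $(S,S)$-biact is a set $A$ with a left action ($s\cdot(s'\cdot a)=(ss')\cdot a$) and a right action ($(a\cdot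 t)\cdot t'=a\cdot(tt')$) of $S$ with $(s\cdot a)\cdot t=s\cdot(a\cdot t)$; its congruences are the equivalence relations compatible with all left and right actions of elements of $S$, and $\mathrm{Cong}(A)$ is the lattice of these. The minimal $\mathscr J$-class $J_1$ is the minimal ideal of $S$, and ${}^S J_1^S$ denotes the $(S,S)$-biact on $J_1$ by left and right multiplication. A stable $\mathscr J$-class $J$ is $\mathscr H$-separable if for all $x,y\in J$ with $(x,y)\notin\mathscr H$ there exist $s,t\in S^1$ such that precisely one of $sxt$, $syt$ belongs to $J$. The (right) Schützenberger group of an $\mathscr H$-class $H$ is the group, under composition, of all maps $H\to H$, $x\mapsto xt$, where $t\in S^1$ satisfies $Ht\subseteq H$; up to isomorphism it depends only on the $\mathscr D$-class containing $H$ (where $\mathscr D=\mathscr L\vee\mathscr R$), and a stable $\mathscr J$-class is a $\mathscr D$-class. $\mathrm{NSub}(\Gamma)$ is the lattice of normal subgroups of $\Gamma$. *)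

(* Defs.v *)
From HB Require Import structures.
From mathcomp Require Import all_boot all_order.
From mathcomp Require Import all_classical.

Set Implicit Arguments.
Unset Strict Implicit.
Unset Printing Implicit Defensive.

Local Open Scope classical_set_scope.
Local Open Scope card_scope.
Local Open Scope group_scope.

(* Cardinals are represented by sets or types of the given cardinality, equality
   of cardinals being [#=].  That any nonempty family of types has a member of
   least cardinality is what makes suprema of cardinals exist; the proof takes
   a maximal set of choice functions any two of which differ everywhere. *)
Lemma inj_card_leT (T U : Type) (f : T -> U) :
  injective f -> [set: T] #<= [set: U].
Proof.
move=> injf; have /card_eqPle[_ ] := inj_card_eq (A := setT) (in2W injf).
by move=> /card_le_trans; apply; exact: card_leT.
Qed.

Lemma least_card (I : Type) (i0 : I) (F : I -> Type) :
  exists i, forall j, [set: F i] #<= [set: F j].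
Proof.
pose P (G : set (forall i, F i)) :=
  forall f g, G f -> G g -> forall i, f i = g i -> f = g.
have [|G [PG maxG]] := @Zorn_bigcup _ P.
  move=> A AP totA f g [B AB Bf] [C AC Cg] i.
  have [BC|CB] := totA _ _ AB AC.
    by apply: (AP _ AC) => //; apply: BC.
  by apply: (AP _ AB) => //; apply: CB.
have [i surj] : exists i, forall x : F i, exists2 f, G f & f i = x.
  apply: contrapT => /forallNP nsurj.
  have exh i : exists x : F i, forall f, G f -> f i <> x.
    have /existsNP[x nx] := nsurj i.
    by exists x => f Gf fx; apply: nx; exists f.
  pose h i := sval (cid (exh i)).
  have hP i f : G f -> f i <> h i by exact: (svalP (cid (exh i))).
  apply: (maxG (G `|` [set h])).
    split; first by move=> f Gf; left.
    by move=> /(_ h) hG; apply: (hP i0 h _ erefl); apply: hG; right.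
  move=> f g [Gf|->] [Gg|->] i // fg; first exact: (PG _ _ Gf Gg i).
    by case: (hP i _ Gf).
  by case: (hP i _ Gg).
exists i => j.
pose g x := s2val (cid2 (surj x)).
have Gg x : G (g x) by exact: (s2valP (cid2 (surj x))).
have gi x : g x i = x by exact: (s2valP' (cid2 (surj x))).
apply: (@inj_card_leT _ _ (fun x => g x j)) => x y gxy.
by rewrite -(gi x) -(gi y) (PG _ _ (Gg x) (Gg y) j gxy).
Qed.

(* Posets are given as subsets of a [porderType], e.g. of [set U] ordered by
   inclusion. *)
Section Height.
Context {d : Order.disp_t} {T : porderType d}.
Implicit Types P C : set T.

Definition chain P C :=
  C `<=` P /\ total_on C (fun x y => (x <= y)%O).

Definition bounds_chains P U (K : set U) := forall C, chain P C -> C #<= K.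

Lemma height_ex P : exists K : set T,
  bounds_chains P K /\ forall U (K' : set U), bounds_chains P K' -> K #<= K'.
Proof.
have PT : bounds_chains P [set: T] by move=> C _; exact: card_leT.
have [[K PK] /= minK] := @least_card {K : set T | bounds_chains P K}
  (exist _ _ PT) (fun K => sval K).
have {}minK (K' : set T) : bounds_chains P K' -> K #<= K'.
  move=> PK'; move: (minK (exist _ _ PK')) => /=.
  by rewrite (card_le_eql (card_setT _)) (card_le_eqr (card_setT _)).
exists K; split=> // U K' PK'.
have [[] /= K'min] :=
    @least_card bool true (fun b => if b then (K' : Type) else T).
- have /card_leP[f] := K'min false.
  pose g x : T := val (f x).
  have injg : injective g by move=> x y /val_inj /(@inj _ _ _ f); apply; rewrite inE.
  have eqf : range g #= K'.
    apply: card_eq_trans (inj_card_eq (in2W injg)) _.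
    exact: card_eq_trans (card_setT _) (card_setT _).
  rewrite -(card_le_eqr eqf); apply: minK => C /PK' /card_le_trans; apply.
  by rewrite (card_le_eqr eqf) card_lexx.
- have := K'min true; rewrite (card_le_eqr (card_setT K')).
  by apply: card_le_trans; exact: card_leT.
Qed.

(* The supremum of the cardinalities of the chains of [P]. *)
Definition height P : set T := sval (cid (height_ex P)).

Lemma height_bound P : bounds_chains P (height P).
Proof. by rewrite /height; case: cid => K []. Qed.

Lemma height_least P U (K : set U) : bounds_chains P K -> height P #<= K.
Proof. exact: (svalP (cid (height_ex P))).2. Qed.

End Height.

Section Green.
Context {S : semigroupType}.
Implicit Types (x y a : S) (s t : option S) (A B : set S).

Definition is_identity e := forall x, e * x = x /\ x * e = x.

(* The elements of S^1: [Some s] for s in S, together with an adjoined identity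
   [None] exactly when S has no identity of its own. *)
Definition S1 : set (option S) :=
  [set s | s = None -> ~ exists e, is_identity e].

Definition mull s x := if s is Some s' then s' * x else x.
Definition mulr x s := if s is Some s' then x * s' else x.

Definition left_ideal x := [set mull s x | s in S1].
Definition right_ideal x := [set mulr x s | s in S1].
Definition ideal x := [set mulr (mull s x) t | s in S1 & t in S1].

Definition greenL x y := left_ideal x = left_ideal y.
Definition greenR x y := right_ideal x = right_ideal y.
Definition greenJ x y := ideal x = ideal y.
Definition greenH x y := greenL x y /\ greenR x y.

Definition hclass a := [set x | greenH a x].
Definition jclass a := [set x | greenJ a x].
Definition jclasses : set (set S) := range jclass.

Definition jle A B := forall x y, A x -> B y -> ideal x `<=` ideal y.

Definition jminimal A :=
  jclasses A /\ forall B, jclasses B -> jle B A -> B = A.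

Definition jstable A := forall x s, A x -> S1 s ->
  (greenJ x (mull s x) -> greenL x (mull s x)) /\
  (greenJ x (mulr x s) -> greenR x (mulr x s)).

(* Only meant for stable J-classes. *)
Definition hseparable A := forall x y, A x -> A y -> ~ greenH x y ->
  exists s t, [/\ S1 s, S1 t &
    (A (mulr (mull s x) t) /\ ~ A (mulr (mull s y) t)) \/
    (~ A (mulr (mull s x) t) /\ A (mulr (mull s y) t))].

End Green.

Definition stable (S : semigroupType) :=
  forall A : set S, jclasses A -> jstable A.

Definition equivalence_set T (r : set (T * T)) :=
  [/\ forall x, r (x, x),
      forall x y, r (x, y) -> r (y, x) &
      forall x y z, r (x, y) -> r (y, z) -> r (x, z)].

Definition Cong (S : semigroupType) : set (set (S * S)) :=
  [set r | equivalence_set r /\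
    forall s x y, r (x, y) -> r (s * x, s * y) /\ r (x * s, y * s)].
Arguments Cong : clear implicits.

Record biact (S : semigroupType) := Biact {
  biact_sort :> Type;
  lact : S -> biact_sort -> biact_sort;
  ract : biact_sort -> S -> biact_sort;
  lactA : forall s s' x, lact s (lact s' x) = lact (s * s') x;
  ractA : forall x t t', ract (ract x t) t' = ract x (t * t');
  lract : forall s x t, ract (lact s x) t = lact s (ract x t) }.

Definition biact_Cong (S : semigroupType) (A : biact S) : set (set (A * A)) :=
  [set r | equivalence_set r /\
    forall s x y, r (x, y) -> r (lact s x, lact s y) /\ r (ract x s, ract y s)].
Arguments biact_Cong {S} A.

Section S1Theory.
Context {S : semigroupType}.
Implicit Types (x y a : S) (s t : option S) (A B : set S).

Definition mul1 s t : option S :=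
  if s is Some s' then Some (mulr s' t) else t.

Lemma mull_mul1 s t x : mull s (mull t x) = mull (mul1 s t) x.
Proof. by case: s t => [s|] [t|] //=; rewrite mulgA. Qed.

Lemma mulr_mul1 x s t : mulr (mulr x s) t = mulr x (mul1 s t).
Proof. by case: s t => [s|] [t|] //=; rewrite mulgA. Qed.

Lemma mullr s x t : mulr (mull s x) t = mull s (mulr x t).
Proof. by case: s t => [s|] [t|] //=; rewrite mulgA. Qed.

Lemma S1_proxy s : exists s', [/\ S1 s', mull s' =1 mull s & mulr^~ s' =1 mulr^~ s].
Proof.
case: s => [s|]; first by exists (Some s); split.
have [[e he]|ne] := pselect (exists e : S, is_identity e).
  by exists (Some e); split=> // x; case: (he x).
by exists None; split.
Qed.

Lemma left_idealP x y : left_ideal x y <-> exists s, y = mull s x.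
Proof.
split=> [[s _ <-]|[s ->]]; first by exists s.
by have [s' [s'1 e _]] := S1_proxy s; exists s'; rewrite ?e.
Qed.

Lemma right_idealP x y : right_ideal x y <-> exists s, y = mulr x s.
Proof.
split=> [[s _ <-]|[s ->]]; first by exists s.
by have [s' [s'1 _ e]] := S1_proxy s; exists s'; rewrite ?e.
Qed.

Lemma idealP x y : ideal x y <-> exists s t, y = mulr (mull s x) t.
Proof.
split=> [[s _ [t _ <-]]|[s [t ->]]]; first by exists s, t.
have [s' [s'1 es _]] := S1_proxy s; have [t' [t'1 _ et]] := S1_proxy t.
by exists s' => //; exists t' => //; rewrite es et.
Qed.

Lemma greenLP x y :
  greenL x y <-> (exists s, y = mull s x) /\ (exists s, x = mull s y).
Proof.
split=> [xy|[[s yE] [t xE]]].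
  split; apply/left_idealP; [rewrite xy|rewrite -xy];
    by apply/left_idealP; exists None.
apply/seteqP; split=> z /left_idealP[u ->]; apply/left_idealP.
  by exists (mul1 u t); rewrite -mull_mul1 -xE.
by exists (mul1 u s); rewrite -mull_mul1 -yE.
Qed.

Lemma greenRP x y :
  greenR x y <-> (exists s, y = mulr x s) /\ (exists s, x = mulr y s).
Proof.
split=> [xy|[[s yE] [t xE]]].
  split; apply/right_idealP; [rewrite xy|rewrite -xy];
    by apply/right_idealP; exists None.
apply/seteqP; split=> z /right_idealP[u ->]; apply/right_idealP.
  by exists (mul1 t u); rewrite -mulr_mul1 -xE.
by exists (mul1 s u); rewrite -mulr_mul1 -yE.
Qed.

Lemma ideal_sub s x t : ideal (mulr (mull s x) t) `<=` ideal x.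
Proof.
move=> z /idealP[u [v ->]]; apply/idealP; exists (mul1 u s), (mul1 t v).
by rewrite -mull_mul1 -mulr_mul1 -!mullr.
Qed.

Lemma jminimal_mul A s x t : jminimal A -> A x -> A (mulr (mull s x) t).
Proof.
move=> [[a _ <-] minA] ax; set y := mulr _ _.
rewrite -(minA (jclass y)) //; first by exists y.
by move=> z w yz aw; rewrite -yz -aw ax; exact: ideal_sub.
Qed.

End S1Theory.

(* A minimal J-class, being an ideal, is a biact under multiplication. *)
Section MinimalBiact.
Context (S : semigroupType) (A : set S) (minA : jminimal A).

Lemma minimal_mull s x : A x -> A (s * x).
Proof. exact: (@jminimal_mul _ _ (Some s) x None minA). Qed.

Lemma minimal_mulr x s : A x -> A (x * s).
Proof. exact: (@jminimal_mul _ _ None x (Some s) minA). Qed.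

Definition minimal_lact s (x : A) : A :=
  SigSub (mem_set (minimal_mull s (set_valP x))).
Definition minimal_ract (x : A) s : A :=
  SigSub (mem_set (minimal_mulr s (set_valP x))).

Definition minimal_biact : biact S.
Proof.
exists A minimal_lact minimal_ract.
- by move=> s s' x; apply: val_inj; rewrite /= mulgA.
- by move=> x t t'; apply: val_inj; rewrite /= mulgA.
- by move=> s x t; apply: val_inj; rewrite /= mulgA.
Defined.

End MinimalBiact.

(* The maps H -> H of the form x |-> xt, with t in S^1; that f takes its values
   in H is the condition Ht <= H. *)
Definition translations (S : semigroupType) (H : set S) : set (H -> H) :=
  [set f | exists2 t, S1 t & forall x : H, val (f x) = mulr (val x) t].

Arguments translations {S} H f.

(* The Schutzenberger group of the H-class of a; every H-class is of this form. *)
Definition schutzenberger (S : semigroupType) (a : S) : Type :=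
  translations (hclass a).

HB.instance Definition _ (S : semigroupType) (a : S) :=
  Choice.on (schutzenberger a).

Section Schutzenberger.
Context (S : semigroupType) (a : S).
Local Notation H := (hclass a).
Local Notation G := (schutzenberger a).

Lemma schutz_id_subproof : translations H id.
Proof. by have [t [t1 _ e]] := @S1_proxy S None; exists t => // x; rewrite e. Qed.

Lemma schutz_comp_subproof (f g : H -> H) :
  translations H f -> translations H g -> translations H (f \o g).
Proof.
move=> [t _ ft] [u _ gu]; have [v [v1 _ e]] := S1_proxy (mul1 u t).
by exists v => // x; rewrite /= ft gu e mulr_mul1.
Qed.

Lemma hclassP x y : H x ->
  H y <-> [/\ exists s, y = mull s x, exists s, x = mull s y,
               exists s, y = mulr x s & exists s, x = mulr y s].
Proof.
move=> [axL axR]; have -> : H y <-> greenH x y.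
  by rewrite /hclass /greenH /= /greenL /greenR axL axR.
split=> [[/greenLP[? ?] /greenRP[? ?]]|[? ? ? ?]]; first by split.
by split; [apply/greenLP|apply/greenRP].
Qed.

(* Green's lemma *)
Lemma schutz_inv_subproof (f : H -> H) : translations H f ->
  exists2 g : H -> H, translations H g & cancel f g /\ cancel g f.
Proof.
move=> [t t1 ft].
have Ha : H a by [].
have Ht x : H x -> H (mulr x t).
  by move=> Hx; have <- := ft (SigSub (mem_set Hx)); exact: set_valP.
have /(hclassP _ Ha)[_ _ _ [u0 aE]] := Ht a Ha.
have [u [u1 _ uE]] := S1_proxy u0.
have tuK x : H x -> mulr (mulr x t) u = x.
  move=> /(hclassP _ Ha)[[s ->] _ _ _].
  by rewrite !mullr /= (uE (mulr a t)) -aE.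
have Hu y : H y -> H (mulr y u) /\ mulr (mulr y u) t = y.
  move=> Hy; have /(hclassP _ (Ht a Ha))[[s yE] [w atE] _ _] := Hy.
  have yuE : mulr y u = mull s a by rewrite yE mullr tuK.
  have yutE : mulr (mulr y u) t = y by rewrite yuE mullr -yE.
  split=> //; have /(hclassP _ Ha)[_ _ [v yv] [v' av']] := Hy.
  apply/(hclassP _ Ha); split.
  - by exists s.
  - by exists w; rewrite -mullr -atE tuK.
  - by exists (mul1 v u); rewrite -mulr_mul1 -yv.
  - by exists (mul1 t v'); rewrite -mulr_mul1 yutE.
exists (fun y : H => SigSub (mem_set (Hu _ (set_valP y)).1) : H).
  by exists u.
split=> x; apply: val_inj; rewrite /= ?ft ?tuK //; first exact: set_valP.
by have [] := Hu _ (set_valP x).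
Qed.

Definition schutz_one : G := SigSub (mem_set schutz_id_subproof).
(* Composing in the other order gives the opposite group, which has the same
   normal subgroups. *)
Definition schutz_mul (f g : G) : G :=
  SigSub (mem_set (schutz_comp_subproof (set_valP f) (set_valP g))).
Definition schutz_inv (f : G) : G :=
  SigSub (mem_set (s2valP (cid2 (schutz_inv_subproof (set_valP f))))).

Lemma schutz_mulA : associative schutz_mul.
Proof. by move=> f g h; apply: val_inj. Qed.

Lemma schutz_mul1g : left_id schutz_one schutz_mul.
Proof. by move=> f; apply: val_inj. Qed.

Lemma schutz_mulg1 : right_id schutz_one schutz_mul.
Proof. by move=> f; apply: val_inj. Qed.

Lemma schutz_mulVg : left_inverse schutz_one schutz_inv schutz_mul.
Proof.
move=> f; apply: val_inj; apply/funext => x /=.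
by case: cid2 => g /= _ [fK _]; exact: fK.
Qed.

Lemma schutz_mulgV : right_inverse schutz_one schutz_inv schutz_mul.
Proof.
move=> f; apply: val_inj; apply/funext => x /=.
by case: cid2 => g /= _ [_ gK]; exact: gK.
Qed.

HB.instance Definition _ := isGroup.Build G
  schutz_mulA schutz_mul1g schutz_mulg1 schutz_mulVg schutz_mulgV.

End Schutzenberger.

Definition NSub (G : groupType) : set (set G) :=
  [set N | [/\ N 1,
    forall x y, N x -> N y -> N (x * y),
    forall x, N x -> N x^-1 &
    forall x g, N x -> N (x ^ g)]].
Arguments NSub : clear implicits.

(* Main.v *)
Require Import Defs.
From HB Require Import structures.
From mathcomp Require Import all_boot all_order.
From mathcomp Require Import all_classical.

Set Implicit Arguments.
Unset Strict Implicit.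
Unset Printing Implicit Defensive.

Local Open Scope classical_set_scope.
Local Open Scope card_scope.

(** Why the formula holds.

    Rank the elements of S by a linear extension of the order of the J-classes,
    so that the elements of rank less than k always form an ideal.

    Upper bound.  Say that a congruence r is degenerate at a J-class if it
    relates some element of that class to an element of smaller rank.  It then
    does so for every element of the class, and what r does up to the class is
    forced by what it does below it ([degenerate_contains_below]).  Otherwise
    H-separability puts r inside H on that class, and there r is determined by
    the normal subgroup of those translations of an H-class that move points
    inside r-classes ([nondegenerate_contains_below]).  For a chain C of
    congruences, code a member r by the last J-class at which some member of
    C with the same restriction below that class is larger than r: then r is not
    degenerate there, so its normal subgroup can be recorded; if there is no
    such J-class above the minimal one, record the restriction of r to the
    minimal ideal.  This code is injective and takes its values in the disjoint
    union of a chain of biact congruences and of chains of normal subgroups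
    ([chain_card_le]).  Using the last such place, rather than the whole
    tuple of restrictions, makes the bound sharp for finite chains and correct
    without change for infinite ones.

    Lower bound.  Given a chain for each summand, stack them: biact congruences
    are extended by equality, and a normal subgroup N of the group of J_r gives
    the congruence that collapses everything of smaller rank and, on J_r, is the
    syntactic congruence of the partition of an H-class into N-orbits.  Stability
    makes N recoverable from this congruence ([nsub_relP]).  The top of one layer
    coincides with the bottom of the next, so the trivial subgroup is sent to the
    top of its layer instead ([step]), which makes the stacking injective
    ([chain_card_ge]).

    Both bounds are about individual chains; [height_sum_le] passes to the
    suprema, which need not be attained when they are infinite. *)

(** * Cardinals and suprema of lengths of chains *)

Lemma card_le_injP (T U : Type) (A : set T) (B : set U) :
  A #<= B <-> exists f : A -> B, injective f.
Proof.
split=> [/card_leP[f]|[f injf]].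
  by exists f => x y; apply: (@inj _ _ _ f); rewrite inE.
rewrite -(card_le_eql (card_setT A)) -(card_le_eqr (card_setT B)).
exact: inj_card_leT injf.
Qed.

(** Take a maximal family of injective sequences with disjoint ranges.  Only
    finitely many elements are left over, and they can be absorbed by one of the
    sequences, so T embeds in G * nat for an index set G; now use that nat * nat
    is equipotent to nat. *)
Lemma infinite_mul_nat (T : Type) :
  infinite_set [set: T] -> [set: T * nat] #<= [set: T].
Proof.
move=> infT.
pose P (G : set (nat -> T)) := (forall g, G g -> injective g) /\
  forall f g, G f -> G g -> forall i j, f i = g j -> f = g.
have [|G [[Ginj Gdisj] maxG]] := @Zorn_bigcup _ P.
  move=> A AP totA; split=> [g [B AB Bg]|f g [B AB Bf] [C AC Cg]].
    by have [+ _] := AP _ AB; apply.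
  have [BC|CB] := totA _ _ AB AC.
    by have [_] := AP _ AC; apply=> //; apply: BC.
  by have [_] := AP _ AB; apply=> //; apply: CB.
pose R := [set x | exists2 g, G g & exists i, g i = x].
(* an infinite remainder would contain one more sequence, against maximality *)
have finR : finite_set (~` R).
  apply: contrapT => /infiniteP/card_le_injP[h injh].
  pose g i := val (h (SigSub (mem_set (I : [set: nat] i)))).
  have nRg i : ~ R (g i) by exact: set_valP (h _).
  have ginj : injective g by move=> i j /val_inj/injh/(congr1 val).
  apply: (maxG (G `|` [set g])).
    split=> [|GgG]; first by left.
    by apply: (nRg 0); exists g; [apply: GgG; right|exists 0].
  split=> [f [/Ginj|->]|f1 f2 [G1|->] [G2|->] i j //]; [by []|by []| | |].
  - exact: Gdisj.
  - by move=> f1i; case: (nRg j); exists f1 => //; exists i.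
  - by move=> f2j; case: (nRg i); exists f2 => //; exists j.
have [g0 Gg0] : exists g0, G g0.
  apply: contrapT => nG; apply: infT; apply: sub_finite_set finR => x _ [g Gg].
  by case: nG; exists g.
pose D := ~` R `|` range g0.
have /countable_injP[c injc] : countable D.
  have -> : D = \bigcup_(b in [set: bool]) (if b then ~` R else range g0).
    apply/seteqP; split=> [x [Rx|gx]|x [[] _ ?]]; last by right.
    - by exists true.
    - by exists false.
    - by left.
  apply: bigcup_countable => // -[] _; first exact: finite_set_countable.
  exact: card_image_le.
(* The countable set D, the leftovers together with the range of g0, is
   renumbered along g0. *)
have dec x : exists gi : G * nat,
    D x /\ gi = (SigSub (mem_set Gg0), c x) \/ val gi.1 <> g0 /\ val gi.1 gi.2 = x.
  have [Dx|nDx] := pselect (D x).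
    by exists (SigSub (mem_set Gg0), c x); left.
  have /contrapT[g Gg [i gi]] : ~ ~ R x by move=> nR; apply: nDx; left.
  exists (SigSub (mem_set Gg), i); right; split=> //= gg0.
  by apply: nDx; right; exists i => //; rewrite -gg0.
pose code x := sval (cid (dec x)).
have injcode : injective code.
  have codeP x := svalP (cid (dec x)).
  move=> x y xy; move: (codeP x) (codeP y); rewrite -/(code x) -/(code y) xy.
  move=> [[Dx ->]|[ng <-]] [[Dy e]|[// _ <-//]].
  - by case: e => /injc; apply; rewrite inE.
  - by rewrite e in ng.
have /card_eqPle[/card_le_injP[pr injpr] _] := card_nat2.
pose pair i j := val (pr (SigSub (mem_set (I : [set: nat * nat] (i, j))))).
apply: (@inj_card_leT _ _ (fun xk => val (code xk.1).1 (pair (code xk.1).2 xk.2))).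
move=> [x k] [y l] /= e.
have Gc z : G (val (code z).1) by exact: set_valP.
have e1 := Gdisj _ _ (Gc x) (Gc y) _ _ e.
move: e; rewrite e1 => /(Ginj _ (Gc y))/val_inj/injpr/(congr1 val)/=[e2 ->].
congr (_, _); apply: injcode; move: e1 e2.
by case: (code x) (code y) => [? ?] [? ?] /= /val_inj -> ->.
Qed.

Lemma chain0 (d : Order.disp_t) (T : porderType d) (P : set T) : chain P set0.
Proof. by split. Qed.

(** A finite supremum of cardinalities is a maximum: if all chains were smaller,
    the predecessor of the supremum would bound them. *)
Lemma height_attained (d : Order.disp_t) (T : porderType d) (P : set T) :
  finite_set (height P) -> exists2 C, chain P C & height P #<= C.
Proof.
move=> finP; have [m Pm] := (finite_setP _).1 finP.
case: m Pm => [|m] Pm.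
  exists set0; first exact: chain0.
  by rewrite (card_le_eql Pm) II0.
apply: contrapT => nC.
have : height P #<= `I_m; last by rewrite (card_le_eql Pm) card_le_II ltnn.
apply: height_least => C CP.
have CleP := height_bound CP.
have [k Ck] := (finite_setP _).1 (card_le_finite CleP finP).
rewrite (card_le_eql Ck) card_le_II -ltnS ltnNge; apply/negP => mk.
apply: nC; exists C => //.
by rewrite (card_le_eql Pm) (card_le_eqr Ck) card_le_II.
Qed.

Lemma sum_card_le (I : eqType) (T0 U0 : Type) (A : set T0) (B : set U0)
    (T U : I -> Type) (A' : forall i, set (T i)) (B' : forall i, set (U i)) :
  A #<= B -> (forall i, A' i #<= B' i) ->
  [set: (A + {i & A' i})%type] #<= [set: (B + {i & B' i})%type].
Proof.
move=> /card_le_injP[f injf] /(_ _)/card_le_injP/cid AB.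
pose g i := sval (AB i); have injg i : injective (g i) := svalP (AB i).
pose h (x : (A + {i & A' i})%type) : (B + {i & B' i})%type :=
  match x with inl x => inl (f x) | inr (existT i x) => inr (existT _ i (g i x)) end.
apply: (@inj_card_leT _ _ h) => -[x|[i x]] [y|[j y]] //= [].
  by move/injf ->.
move=> ij; move: y; case: _ / ij => y e.
by congr (inr (existT _ _ _)); apply: (injg i); exact: eq_from_Tagged e.
Qed.

(** A sum of suprema is the supremum of the sums.  If K is finite, the suprema
    are maxima and the hypothesis applies to chains attaining them.  If K is
    infinite, each summand is at most K (the other chains being taken empty), and
    finitely many copies of K fit into K. *)
Lemma height_sum_le (n : nat) (d0 d : Order.disp_t) (T0 : porderType d0)
    (T : 'I_n -> porderType d) (P0 : set T0) (P : forall r, set (T r))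
    (U : Type) (K : set U) :
  (forall C0 C, chain P0 C0 -> (forall r, chain (P r) (C r)) ->
    [set: (C0 + {r & C r})%type] #<= K) ->
  [set: (height P0 + {r & height (P r)})%type] #<= K.
Proof.
move=> leK.
have le0 : height P0 #<= K.
  apply: height_least => C0 C0P.
  apply: card_le_trans (leK C0 (fun=> set0) C0P (fun r => chain0 (P r))).
  by rewrite -(card_le_eql (card_setT C0)); apply: (@inj_card_leT _ _ inl) => x y [].
have le1 r : height (P r) #<= K.
  apply: height_least => C CP.
  pose T' s : Type := T s.
  (* the family of chains equal to C at index r and empty elsewhere *)
  pose C' s := [set x | exists2 y : T r, C y & existT T' r y = existT T' s x].
  have C'r (x : C) : C' r (val x) by exists (val x) => //; exact: set_valP.
  apply: card_le_trans (leK set0 C' (chain0 P0) _).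
    rewrite -(card_le_eql (card_setT C)).
    pose f (x : C) : (set0 : set T0) + {s & C' s} :=
      inr (existT (fun s => C' s : Type) r (SigSub (mem_set (C'r x)))).
    apply: (@inj_card_leT _ _ f) => x y fxy; apply: val_inj.
    have e := inr_inj fxy.
    by case: (eq_from_Tagged e).
  case: CP => CP totC s.
  have toC x : C' s x -> exists2 e : r = s, True & C (ecast s (T s) (esym e) x).
    case=> y Cy e; have rs : r = s := congr1 tag e.
    move: x e; case: s / rs => x e; exists erefl => //=.
    by rewrite -(eq_from_Tagged e).
  split=> [x /toC[e _]|x y /toC[e _ Cx] /toC[e' _]].
    by case: _ / e x => x /CP.
  rewrite (Prop_irrelevance e' e); case: _ / e x y Cx {e'} => x y Cx Cy; exact: totC.
have [finK|infK] := pselect (finite_set K).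
  have fin0 := card_le_finite le0 finK.
  have fin1 r := card_le_finite (le1 r) finK.
  have [C0 C0P C0h] := height_attained fin0.
  have exC r : exists C, chain (P r) C /\ height (P r) #<= C.
    by have [C] := height_attained (fin1 r); exists C.
  pose C r := sval (cid (exC r)); have CP r := svalP (cid (exC r)).
  apply: card_le_trans (leK C0 C C0P (fun r => (CP r).1)).
  by apply: sum_card_le => // r; exact: (CP r).2.
have infK' : infinite_set [set: K].
  apply: contra_not infK; apply: card_le_finite.
  by rewrite (card_le_eqr (card_setT K)).
apply: card_le_trans; last first.
  by rewrite -(card_le_eqr (card_setT K)); exact: infinite_mul_nat infK'.
move: le0 => /card_le_injP[f injf]; move: le1 => /(_ _)/card_le_injP/cid le1.
pose g r := sval (le1 r); have injg r : injective (g r) := svalP (le1 r).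
pose h (x : (height P0 + {r & height (P r)})%type) : K * nat :=
  match x with inl x => (f x, 0) | inr (existT r x) => (g r x, (nat_of_ord r).+1) end.
apply: (@inj_card_leT _ _ h) => -[x|[r x]] [y|[s y]] //= [].
  by move/injf ->.
move=> + /val_inj rs; case: _ / rs y => y /injg ->.
by [].
Qed.

(** * Green's relations in a stable semigroup *)

Section Green.
Variable S : semigroupType.
Implicit Types (x y z a : S) (s t : option S).

Lemma ideal_refl x : ideal x x.
Proof. by apply/idealP; exists None, None. Qed.

Lemma ideal_mul s x t : ideal x (mulr (mull s x) t).
Proof. by apply/idealP; exists s, t. Qed.

Lemma ideal_leP x y : ideal x `<=` ideal y <-> ideal y x.
Proof.
split=> [|/idealP[s [t ->]]]; last exact: ideal_sub.
by apply; exact: ideal_refl.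
Qed.

Lemma greenJP x y : greenJ x y <-> ideal x y /\ ideal y x.
Proof.
split=> [xy|[/ideal_leP yx /ideal_leP xy]]; last exact/seteqP.
by split; [rewrite xy|rewrite -xy]; exact: ideal_refl.
Qed.

Lemma greenL_J x y : greenL x y -> greenJ x y.
Proof.
by move=> /greenLP[[s yE] [t xE]]; apply/greenJP; split; apply/idealP;
  [exists s, None|exists t, None].
Qed.

Lemma greenH_J x y : greenH x y -> greenJ x y.
Proof. by case=> /greenL_J. Qed.

Hypothesis stS : stable S.

Lemma stable_mull x s : greenJ x (mull s x) -> greenL x (mull s x).
Proof.
have [s' [s1 sE _]] := S1_proxy s; rewrite -sE.
by have [] := stS (imageP jclass I : jclasses (jclass x)) (erefl _ : jclass x x) s1.
Qed.

Lemma stable_mulr x s : greenJ x (mulr x s) -> greenR x (mulr x s).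
Proof.
have [s' [s1 _ sE]] := S1_proxy s; move: (sE x) => /= <-.
by have [] := stS (imageP jclass I : jclasses (jclass x)) (erefl _ : jclass x x) s1.
Qed.

(** Stability applied first on the right and then on the left: a two-sided
    multiplication that stays in the J-class moves along an R-class and then along
    an L-class. *)
Lemma stable_mul x p q : greenJ x (mulr (mull p x) q) ->
  greenR x (mulr x q) /\ greenL (mulr x q) (mulr (mull p x) q).
Proof.
move=> /greenJP[xpxq pxqx].
have qpq : ideal (mulr x q) (mulr (mull p x) q).
  by rewrite mullr; exact: (ideal_mul p _ None).
have xq : greenJ x (mulr x q).
  apply/greenJP; split; first exact: (ideal_mul None).
  by move/ideal_leP: qpq; apply.
split; first exact: stable_mulr.
by rewrite mullr; apply: stable_mull; rewrite -mullr /greenJ -xq; apply/greenJP.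
Qed.

End Green.

(** * The action of the Schutzenberger group *)

Section Translations.
Variables (S : semigroupType) (a : S).
Implicit Types (x y z : S) (s t p q : option S).
Local Notation H := (hclass a).
Local Notation G := (schutzenberger a).

Lemma translationP (f : G) : exists t, forall x : H, val (val f x) = mulr (val x) t.
Proof. by have [t _ ft] := set_valP f; exists t. Qed.

(** Right translations commute with left multiplications; since an H-class lies
    in one L-class, a translation is determined by any one of its values. *)
Lemma translation_mull (f : G) (x y : H) s :
  val x = mull s (val y) -> val (val f x) = mull s (val (val f y)).
Proof. by have [t ft] := translationP f; rewrite !ft => ->; rewrite mullr. Qed.

Lemma hclass_L (x y : H) : exists s, val x = mull s (val y).
Proof. by have /(hclassP _ (set_valP y))[] := set_valP x. Qed.

Lemma hclass_R (x y : H) : exists s, val x = mulr (val y) s.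
Proof. by have /(hclassP _ (set_valP y))[] := set_valP x. Qed.

Lemma translation_free (f g : G) (x : H) : val f x = val g x -> f = g.
Proof.
move=> fg; apply: val_inj; apply/funext => y; apply: val_inj.
have [s ys] := hclass_L y x.
by rewrite !(translation_mull _ ys) fg.
Qed.

(** Green's lemma: once a single point of the H-class is kept inside it by a right
    multiplication, all of them are. *)
Lemma translation_ex (x : H) t : H (mulr (val x) t) ->
  exists f : G, forall y : H, val (val f y) = mulr (val y) t.
Proof.
move=> Hxt; have [t' [t1 _ tE]] := S1_proxy t.
have Ht (y : H) : H (mulr (val y) t').
  rewrite tE; apply/(hclassP _ Hxt).
  have [s ys] := hclass_L y x; have [s' xs] := hclass_L x y.
  have [u xu] := hclass_R x (SigSub (mem_set Hxt)).
  have [v yv] := hclass_R y x; have [v' xv] := hclass_R x y.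
  rewrite /= in xu.
  have yu : val y = mulr (mulr (val y) t) u by rewrite ys !mullr -xu.
  split.
  - by exists s; rewrite ys mullr.
  - by exists s'; rewrite xs mullr.
  - by exists (mul1 u (mul1 v t)); rewrite -!mulr_mul1 -xu -yv.
  - by exists (mul1 u (mul1 v' t)); rewrite -!mulr_mul1 -yu -xv.
have fT : translations H (fun y : H => SigSub (mem_set (Ht y)) : H) by exists t'.
by exists (SigSub (mem_set fT)) => y; rewrite /= tE.
Qed.

Lemma schutz_mulE (f g : G) (x : H) : val (f * g)%g x = val f (val g x).
Proof. by []. Qed.

Lemma schutz_VK (f : G) : cancel (val f) (val (f^-1)%g).
Proof. by move=> x; rewrite -schutz_mulE mulVg. Qed.

Lemma schutz_KV (f : G) : cancel (val (f^-1)%g) (val f).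
Proof. by move=> x; rewrite -schutz_mulE mulgV. Qed.

Lemma translation_transitive (x y : H) : exists f : G, val f x = y.
Proof.
have [t yt] := hclass_R y x.
have [|f ft] := @translation_ex x t; first by rewrite -yt; exact: set_valP.
by exists f; apply: val_inj; rewrite ft.
Qed.

End Translations.

(** Green's lemma in a stable J-class: H-related elements of the class of a are
    moved together into the H-class of a by a two-sided multiplication, and back
    by another one.  This is why normal subgroups of one Schutzenberger group
    control a congruence on the whole J-class. *)
Lemma hclass_transfer (S : semigroupType) (a x y : S) :
  stable S -> greenJ a x -> greenH x y ->
  exists (z : hclass a) (f : schutzenberger a) (p q p' q' : option S),
    [/\ val z = mulr (mull p x) q, val (val f z) = mulr (mull p y) q,
        x = mulr (mull p' (val z)) q' & y = mulr (mull p' (val (val f z))) q'].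
Proof.
move=> stS ax [/greenLP[[m ymx] [m' xmy]] /greenRP[[w yxw] [w' xyw]]].
have /greenJP[_ /idealP[p [q aE]]] := ax.
have [] := @stable_mul S stS x p q; first by rewrite -aE.
rewrite -aE => /greenRP[_ [q' xE]] xqL.
have [_ [p' xqE]] := (greenLP _ _).1 xqL.
have yqE : mulr (mulr y q) q' = y by rewrite {1}ymx !mullr -xE -ymx.
have yqm : mulr y q = mulr (mulr x q) (mul1 (mul1 q' w) q).
  by rewrite -!mulr_mul1 -xE -yxw.
have xqm : mulr x q = mulr (mulr y q) (mul1 (mul1 q' w') q).
  by rewrite -!mulr_mul1 yqE -xyw.
have p'p : mull p' (mull p (mulr y q)) = mulr y q.
  by rewrite yqm -[mull p (mulr (mulr x q) _)]mullr -(mullr p x) -aE -mullr -xqE.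
have Hpyq : hclass a (mulr (mull p y) q).
  split; [apply/greenLP|apply/greenRP]; split.
  - by exists (mul1 p (mul1 m p')); rewrite -!mull_mul1 -xqE ymx !mullr.
  - exists (mul1 (mul1 p m') p').
    by rewrite -!mull_mul1 (mullr p y) p'p -(mullr m' y) -xmy -mullr.
  - by exists (mul1 (mul1 q' w) q); rewrite aE !mullr yqm.
  - by exists (mul1 (mul1 q' w') q); rewrite aE !mullr xqm.
pose z : hclass a := SigSub (mem_set (conj erefl erefl : hclass a a)).
have [f fz] := translation_transitive z (SigSub (mem_set Hpyq)).
exists z, f, p, q, p', q'; rewrite fz; split=> //=.
  by rewrite -xqE -xE.
by rewrite (mullr p y) p'p yqE.
Qed.

(** * Congruences and normal subgroups *)

Section Cong.
Variables (S : semigroupType) (r : set (S * S)) (Cr : Cong S r).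

Lemma cong_refl x : r (x, x). Proof. by case: Cr => -[]. Qed.
Lemma cong_sym x y : r (x, y) -> r (y, x).
Proof. by case: Cr => -[_ + _] _; exact. Qed.
Lemma cong_trans x y z : r (x, y) -> r (y, z) -> r (x, z).
Proof. by case: Cr => -[_ _ +] _; exact. Qed.

Lemma cong_mul s t x y : r (x, y) -> r (mulr (mull s x) t, mulr (mull s y) t).
Proof.
have [_ rM] := Cr; move=> xy; have {}xy : r (mull s x, mull s y).
  by case: s => [s|] //=; have [] := rM s _ _ xy.
by case: t => [t|] //=; have [] := rM t _ _ xy.
Qed.

End Cong.

Section NormalSubgroups.
Variables (S : semigroupType) (a : S).
Implicit Types (x y : S) (s t p q : option S).
Local Notation H := (hclass a).
Local Notation G := (schutzenberger a).

Definition cong_nsub (r : set (S * S)) : set G :=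
  [set f | forall x : H, r (val x, val (val f x))].

Lemma cong_nsubP r (f : G) (x : H) : Cong S r ->
  r (val x, val (val f x)) -> cong_nsub r f.
Proof.
move=> Cr rx y; have [s ys] := hclass_L y x.
by rewrite (translation_mull _ ys) ys; exact: (cong_mul Cr s None).
Qed.

Lemma cong_nsub_NSub r : Cong S r -> NSub G (cong_nsub r).
Proof.
move=> Cr; split=> [x|f g Nf Ng x|f Nf x|f g Nf x].
- exact: cong_refl.
- exact: cong_trans (Ng x) (Nf (val g x)).
- by apply: cong_sym => //; have := Nf (val (f^-1)%g x); rewrite schutz_KV.
- rewrite /conjg !schutz_mulE -{1}(schutz_VK g x).
  have [t gt] := translationP (g^-1)%g.
  by rewrite !gt; exact: (cong_mul Cr None t (Nf (val g x))).
Qed.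

Lemma cong_nsub_mono r r' : r `<=` r' -> cong_nsub r `<=` cong_nsub r'.
Proof. by move=> rr' f fr x; apply: rr'. Qed.

Variables (N : set G).

(** For a subgroup N, the equivalence whose classes are the N-orbits in the H-class
    of a, together with the complement of that H-class. *)
Definition orbit_rel x y := H x \/ H y ->
  exists z : H, exists2 f, N f & x = val z /\ y = val (val f z).

(** For a subgroup N, the syntactic congruence of [orbit_rel], that is the largest
    congruence contained in it. *)
Definition nsub_rel x y :=
  forall p q, orbit_rel (mulr (mull p x) q) (mulr (mull p y) q).

Lemma nsub_rel_mul s t x y :
  nsub_rel x y -> nsub_rel (mulr (mull s x) t) (mulr (mull s y) t).
Proof.
by move=> xy p q; rewrite -!mullr !mull_mul1 !mulr_mul1; exact: xy.
Qed.

Hypothesis NN : NSub G N.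

Lemma orbit_rel_sym x y : orbit_rel x y -> orbit_rel y x.
Proof.
move=> xy /or_comm/xy[z [f Nf [-> ->]]].
exists (val f z), (f^-1)%g; first by case: NN => _ _ + _; apply.
by rewrite schutz_VK.
Qed.

Lemma nsub_rel_sym x y : nsub_rel x y -> nsub_rel y x.
Proof. by move=> xy p q; exact: orbit_rel_sym. Qed.

Lemma orbit_rel_H x y : orbit_rel x y -> H x <-> H y.
Proof.
by move=> xy; split=> Hx; [case: xy; first by left|case: xy; first by right];
  move=> z [f _ [xE yE]]; rewrite ?xE ?yE; exact: set_valP.
Qed.

Lemma nsub_rel_trans x y z : nsub_rel x y -> nsub_rel y z -> nsub_rel x z.
Proof.
move=> xy yz p q Hxz; have {}xy := xy p q; have {}yz := yz p q.
have Hy : H (mulr (mull p y) q).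
  by case: Hxz => [/(orbit_rel_H xy)|/(orbit_rel_H yz)].
have [u [f Nf [-> yE]]] := xy (or_intror Hy).
have [v [g Ng [yE' ->]]] := yz (or_introl Hy).
exists u, (g * f)%g; first by case: NN => _ + _ _; apply.
by split=> //; congr (val (val g _)); apply: val_inj; rewrite -yE -yE'.
Qed.

(** The elements that can be multiplied into the H-class of a are those J-above a,
    and related elements are multiplied into it by the same pairs (p, q). *)
Lemma nsub_rel_above x y : nsub_rel x y -> ideal x a -> ideal y a.
Proof.
move=> xy /idealP[p [q aE]]; have := xy p q; rewrite -aE => -[]; first by left.
move=> z [f _ [_ yE]]; apply/ideal_leP.
have /greenH_J -> : greenH a (mulr (mull p y) q) by rewrite yE; exact: set_valP.
exact: ideal_sub.
Qed.

Hypothesis stS : stable S.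

(** By stability z q is already in the H-class of a, so right multiplication by q
    is a translation g there, while left multiplication by p commutes with
    translations.  Hence the two-sided multiplication carries f to its conjugate
    by g, which is in N by normality. *)
Lemma nsub_rel_half (f : G) (z : H) p q : N f -> H (mulr (mull p (val z)) q) ->
  exists z' : H, exists2 g, N g &
    mulr (mull p (val z)) q = val z' /\
    mulr (mull p (val (val f z))) q = val (val g z').
Proof.
move=> Nf Hpzq.
have zJ : greenJ (val z) (mulr (mull p (val z)) q).
  by rewrite /greenJ -(greenH_J Hpzq) -(greenH_J (set_valP z)).
have [zR zL] := stable_mul stS zJ.
have Hzq : H (mulr (val z) q).
  have [_ aR] : H (val z) by exact: set_valP.
  have [aL _] := Hpzq.
  by split; [rewrite /greenL zL|rewrite /greenR aR].
have [g gq] := translation_ex Hzq.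
have gz : val (val g z) = mulr (val z) q by rewrite gq.
exists (SigSub (mem_set Hpzq)), (g * f * g^-1)%g.
  by case: NN => _ _ _ /(_ f (g^-1)%g Nf); rewrite /conjg invgK mulgA.
split=> //; rewrite mullr -gq.
have -> : val g (val f z) = val (g * f * g^-1)%g (val g z).
  by rewrite !schutz_mulE schutz_VK.
by symmetry; apply: translation_mull; rewrite /= mullr gz.
Qed.

(** Translations act freely, so the N-orbits, which [nsub_rel] separates already for
    trivial p and q, give N back. *)
Lemma nsub_relP (f : G) (z : H) : nsub_rel (val z) (val (val f z)) <-> N f.
Proof.
split=> [zf|Nf p q].
  have [|y [g Ng [/val_inj <-]]] := zf None None; first by left; exact: set_valP.
  by move=> /val_inj/translation_free ->.
move=> [Hz|Hz]; first exact: nsub_rel_half.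
have Nf' : N (f^-1)%g by case: NN => _ _ + _; apply.
have [y [g Ng [yE]]] := nsub_rel_half Nf' Hz.
rewrite schutz_VK => zE; exists (val g y), (g^-1)%g; last by rewrite schutz_VK.
by case: NN => _ _ + _; apply.
Qed.

End NormalSubgroups.

(** * A linear extension of the order of the J-classes *)

Section Rank.
Variables (S : semigroupType) (n : nat) (J : 'I_n -> set S).
Hypothesis bijJ : set_bij [set: 'I_n] jclasses J.

Lemma jclass_index x : exists r, J r = jclass x.
Proof.
have [_ _ surjJ] := bijJ.
by have [r _ <-] := surjJ (jclass x) (imageP jclass I); exists r.
Qed.

Lemma J_jclass r x : J r x -> J r = jclass x.
Proof.
have [funJ _ _] := bijJ.
by have [y _ <-] := funJ r I; rewrite /jclass /greenJ /= => ->.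
Qed.

Lemma J_inj r s : J r = J s -> r = s.
Proof. by have [_ injJ _] := bijJ => /injJ; apply; rewrite inE. Qed.

(** Counting the J-classes below x gives a strictly monotone map; the index of the
    class of x, as a lower-order digit in base n, makes it injective on
    classes. *)
Lemma jrank_ex : exists rk : S -> nat,
  [/\ forall x y, ideal x y -> (rk y <= rk x)%N,
      forall x y, rk x = rk y -> greenJ x y &
      exists b, forall x, (rk x < b)%N].
Proof.
pose idx x := sval (cid (jclass_index x)).
have idxP x : J (idx x) = jclass x by exact: svalP (cid (jclass_index x)).
pose below x := [pred j : 'I_n | `[< exists2 y, J j y & ideal x y >]].
pose c x := #|below x|.
have sub x y : ideal x y -> {subset below y <= below x}.
  move=> xy j /asboolP[z Jz yz].
  by apply/asboolP; exists z => //; move/ideal_leP: xy; apply.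
have cle x y : ideal x y -> (c y <= c x)%N.
  by move=> xy; apply/subset_leq_card/fintype.subsetP/sub.
have clt x y : ideal x y -> ~ ideal y x -> (c y < c x)%N.
  move=> xy nyx; apply/proper_card/properP; split.
    exact/fintype.subsetP/sub.
  exists (idx x); first by apply/asboolP; exists x; [rewrite idxP|exact: ideal_refl].
  apply/negP => /asboolP[z]; rewrite idxP => xz yz; apply: nyx.
  by apply/ideal_leP; rewrite xz; exact/ideal_leP.
exists (fun x => c x * n + idx x)%N; split.
- move=> x y xy; have [yx|nyx] := pselect (ideal y x).
    have -> : idx x = idx y.
      have xyJ : greenJ x y by exact/greenJP.
      by apply: J_inj; rewrite !idxP /jclass /greenJ xyJ.
    by rewrite leq_add2r leq_mul2r cle ?orbT.
  apply: (@leq_trans ((c y).+1 * n)); first by rewrite mulSn addnC leq_add2r ltnW.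
  by rewrite (leq_trans _ (leq_addr _ _))// leq_mul2r clt ?orbT.
- move=> x y /(congr1 (modn^~ n)); rewrite !modnMDl !modn_small // => /ord_inj e.
  have : jclass x x by [].
  by rewrite -idxP e idxP => /esym.
- exists (n.+1 * n)%N => x; rewrite mulSn addnC -addSn leq_add // leq_mul2r.
  by rewrite -[X in (_ <= X)%N](card_ord n) max_card orbT.
Qed.

End Rank.

(** * The upper bound *)

Section Below.
Variables (S : semigroupType) (rk : S -> nat).
Hypothesis stS : stable S.
Hypothesis rk_ideal : forall x y, ideal x y -> (rk y <= rk x)%N.
Hypothesis rk_greenJ : forall x y, rk x = rk y -> greenJ x y.

Lemma greenJ_rk x y : greenJ x y -> rk x = rk y.
Proof.
by move=> /greenJP[/rk_ideal xy /rk_ideal yx]; apply/eqP; rewrite eqn_leq xy yx.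
Qed.

Lemma rk_mul s x t : (rk (mulr (mull s x) t) <= rk x)%N.
Proof. exact/rk_ideal/ideal_mul. Qed.

Definition degenerate (r : set (S * S)) k :=
  exists x y, [/\ r (x, y), rk x = k & (rk y < k)%N].

Lemma degenerate_mono r r' k : r `<=` r' -> degenerate r k -> degenerate r' k.
Proof. by move=> rr' [x [y [rxy xk yk]]]; exists x, y; split => //; exact: rr'. Qed.

(** A J-class is generated by any of its elements under two-sided multiplication,
    and such multiplications do not raise the rank. *)
Lemma degenerate_all r k x : Cong S r -> degenerate r k -> rk x = k ->
  exists2 y, r (x, y) & (rk y < k)%N.
Proof.
move=> Cr [z [y [rzy <- yz]]] /rk_greenJ/greenJP[_ /idealP[s [t ->]]].
exists (mulr (mull s y) t); first exact: cong_mul.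
exact: leq_ltn_trans (rk_mul _ _ _) yz.
Qed.

(** If x and y were not H-related, separability would multiply one of them out of
    the J-class, hence to a smaller rank, while keeping the other inside. *)
Lemma nondegenerate_H r a x y : Cong S r -> hseparable (jclass a) ->
  ~ degenerate r (rk a) -> r (x, y) -> rk x = rk a -> rk y = rk a -> greenH x y.
Proof.
move=> Cr sepa ndr rxy /esym xa /esym ya; apply: contrapT => nxy.
have low s u t : rk a = rk u -> ~ jclass a (mulr (mull s u) t) ->
    (rk (mulr (mull s u) t) < rk a)%N.
  move=> ua nJ; rewrite ltn_neqAle {2}ua rk_mul andbT; apply/eqP => /esym.
  by move/rk_greenJ.
have [s [t [_ _ [[Jx nJy]|[nJx Jy]]]]] := sepa x y (rk_greenJ xa) (rk_greenJ ya) nxy.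
  apply: ndr; exists (mulr (mull s x) t), (mulr (mull s y) t); split.
  - exact: cong_mul.
  - by rewrite (greenJ_rk Jx).
  - exact: low.
apply: ndr; exists (mulr (mull s y) t), (mulr (mull s x) t); split.
- by apply: cong_mul => //; exact: cong_sym.
- by rewrite (greenJ_rk Jy).
- exact: low.
Qed.

Definition contains_below k (r r' : set (S * S)) :=
  forall x y, (rk x < k)%N -> (rk y < k)%N -> r' (x, y) -> r (x, y).

Lemma contains_below_sub k r r' : r' `<=` r -> contains_below k r r'.
Proof. by move=> r'r x y _ _ /r'r. Qed.

(** Every element of rank k is r-related to one of smaller rank, so a pair of r'
    up to rank k can be replaced by a pair below rank k. *)
Lemma degenerate_contains_below k r r' : Cong S r -> Cong S r' -> r `<=` r' ->
  degenerate r k -> contains_below k r r' -> contains_below k.+1 r r'.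
Proof.
move=> Cr Cr' rr' degr ag x y.
have low z : (rk z < k.+1)%N -> exists2 z', r (z, z') & (rk z' < k)%N.
  rewrite ltnS leq_eqVlt => /orP[/eqP zk|zk]; first exact: degenerate_all.
  by exists z => //; exact: cong_refl.
move=> /low[x' xx' x'k] /low[y' yy' y'k] xy.
apply: cong_trans (xx') _ => //; apply: cong_trans (cong_sym Cr yy') => //.
apply: ag => //; apply: cong_trans (cong_sym Cr' (rr' _ xx')) _ => //.
exact: cong_trans (rr' _ yy').
Qed.

(** Up to rank k = rk a, a pair of r' either lies below rank k or is a pair of
    H-related elements of the class of a.  The latter is transferred to the
    H-class of a, where belonging to r' means that a translation belongs to the
    normal subgroup of r'. *)
Lemma nondegenerate_contains_below a r r' : Cong S r -> Cong S r' ->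
  hseparable (jclass a) -> ~ degenerate r' (rk a) -> contains_below (rk a) r r' ->
  @cong_nsub S a r' `<=` @cong_nsub S a r -> contains_below (rk a).+1 r r'.
Proof.
move=> Cr Cr' sepa ndr' ag N'N.
have top x y : rk x = rk a -> rk y = rk a -> r' (x, y) -> r (x, y).
  move=> xa ya xy; have xyH := nondegenerate_H Cr' sepa ndr' xy xa ya.
  have [z [f [p [q [p' [q' [zE fzE xE yE]]]]]]] :=
    hclass_transfer stS (rk_greenJ (esym xa)) xyH.
  rewrite xE yE; apply: cong_mul => //; apply: N'N.
  by apply: (@cong_nsubP _ _ _ _ z) => //; rewrite zE fzE; exact: cong_mul.
have low x y : rk x = rk a -> (rk y < rk a)%N -> ~ r' (x, y).
  by move=> xa ya xy; apply: ndr'; exists x, y.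
move=> x y; rewrite !ltnS => xa ya xy.
move: xa; rewrite leq_eqVlt => /orP[/eqP xa|xa].
  move: ya; rewrite leq_eqVlt => /orP[/eqP ya|ya]; first exact: top.
  by case: (low _ _ xa ya).
move: ya; rewrite leq_eqVlt => /orP[/eqP ya|ya]; last exact: ag.
by case: (low _ _ ya xa); exact: cong_sym.
Qed.

Section UpperBound.
Variables (n : nat) (a0 : S) (a : 'I_n -> S) (V : Type) (phi : set (S * S) -> V).
Variable C : set (set (S * S)).
Hypothesis chainC : chain (Cong S) C.
Hypothesis rk_bound : exists b, forall x, (rk x < b)%N.
Hypothesis rk_cover : forall x, (rk a0 < rk x)%N -> exists r, rk x = rk (a r).
Hypothesis sep_a : forall r, hseparable (jclass (a r)).
Hypothesis phi_below : forall r r', C r -> C r' ->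
  phi r = phi r' -> contains_below (rk a0).+1 r r'.

Let CC r : C r -> Cong S r.
Proof. by case: chainC => + _; exact. Qed.

Let totC r r' : C r -> C r' -> r `<=` r' \/ r' `<=` r.
Proof.
case: chainC => _ tot Cr Cr'.
by case: (tot r r' Cr Cr') => /subsetPset; [left|right].
Qed.

(** As C is a chain, this says that among its members with the same restriction
    below rank k as r, some become larger than r at rank k. *)
Definition jumps r k :=
  exists2 r', C r' & contains_below k r r' /\ ~ contains_below k.+1 r r'.

(** Without further jumps, agreement propagates upwards one rank at a time. *)
Lemma contains_below_climb r r' k : C r' -> (forall j, (k < j)%N -> ~ jumps r j) ->
  contains_below k.+1 r r' -> r' `<=` r.
Proof.
move=> Cr' nj agk.
have ag i : contains_below (k.+1 + i) r r'.
  elim: i => [|i IH]; first by rewrite addn0.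
  rewrite addnS; apply: contrapT => nag; apply: (nj (k.+1 + i)%N).
    by rewrite addSn ltnS leq_addr.
  by exists r'.
have [b rkb] := rk_bound.
move=> [x y]; apply: (ag b); exact: leq_trans (rkb _) (leq_addl _ _).
Qed.

Lemma jumps_rk r k : C r -> jumps r k -> exists x, rk x = k.
Proof.
move=> Cr [r' Cr' [ag nag]]; apply: contrapT => nx; apply: nag => x y.
rewrite !ltnS leq_eqVlt => /orP[/eqP xk|xk]; first by case: nx; exists x.
by rewrite leq_eqVlt => /orP[/eqP yk|yk]; [case: nx; exists y|exact: ag].
Qed.

(** A degenerate member is determined at rank k by its restriction below k, so no
    other member can exceed it there. *)
Lemma jumps_nondegenerate r k : C r -> jumps r k -> ~ degenerate r k.
Proof.
move=> Cr [r' Cr' [ag nag]] degr; apply: nag.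
have [rr'|r'r] := totC Cr Cr'; last exact: contains_below_sub.
by apply: degenerate_contains_below => //; exact: CC.
Qed.

Lemma last_jump r : C r -> (forall j, (rk a0 < j)%N -> ~ jumps r j) \/
  exists i, jumps r (rk (a i)) /\ forall j, (rk (a i) < j)%N -> ~ jumps r j.
Proof.
move=> Cr; have [nj|] := pselect (forall j, (rk a0 < j)%N -> ~ jumps r j).
  by left.
move=> /existsNP[j /not_implyP[a0j /contrapT jj]]; right.
pose P k := `[< (rk a0 < k)%N /\ jumps r k >].
have exP : exists k, P k by exists j; apply/asboolP.
have [b rkb] := rk_bound.
have ubP k : P k -> (k <= b)%N.
  by move=> /asboolP[_ /(jumps_rk Cr)[x <-]]; exact: ltnW.
case: (ex_maxnP exP ubP) => k /asboolP[a0k jk] maxk.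
have [x xk] := jumps_rk Cr jk; rewrite -xk in a0k.
have [i ik] := rk_cover a0k; exists i; rewrite -ik xk; split=> // l kl jl.
have /maxk : P l by apply/asboolP; split=> //; apply: ltn_trans kl; rewrite -xk.
by rewrite leqNgt kl.
Qed.

(** Injectivity of the code.  Let r be contained in r', both jumping last at the
    same J-class and with the same normal subgroup there.  If they agreed below
    that class, they would agree at it, and then everywhere.  If they did not, the
    member s witnessing the jump of r could not contain r', so it would lie
    between r and r'; having the same normal subgroup as both, it would not exceed
    r at that class. *)
Lemma chain_card_le :
  C #<= [set: ((phi @` C) + {i & (@cong_nsub S (a i)) @` C})%type].
Proof.
have code (r : C) : exists c : (phi @` C) + {i & (@cong_nsub S (a i)) @` C},
    match c with
    | inl v => val v = phi (val r) /\ forall j, (rk a0 < j)%N -> ~ jumps (val r) j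
    | inr (existT i N) => val N = @cong_nsub S (a i) (val r) /\
        jumps (val r) (rk (a i)) /\ forall j, (rk (a i) < j)%N -> ~ jumps (val r) j
    end.
  have Cr : C (val r) := set_valP r.
  have [nj|[i ij]] := last_jump Cr.
    by exists (inl (SigSub (mem_set (imageP phi Cr)))).
  by exists (inr (existT _ i (SigSub (mem_set (imageP (@cong_nsub S (a i)) Cr))))).
pose f r := sval (cid (code r)); have fP r := svalP (cid (code r)).
rewrite -(card_le_eql (card_setT C)); apply: (@inj_card_leT _ _ f) => r r' frr'.
apply: val_inj; move: (fP r) (fP r'); rewrite -/(f r) -/(f r') -frr'.
case: r r' {fP frr'} (f r) => [r /= /set_mem Cr] [r' /= /set_mem Cr'].
case=> [v [-> nj] [phiE nj']|[i N] [-> [j nj]] [NE [j' nj']]].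
  apply/seteqP; split.
    by apply: (contains_below_climb Cr nj'); exact: phi_below.
  by apply: (contains_below_climb Cr' nj); exact: phi_below.
wlog rr' : r r' Cr Cr' j nj j' nj' NE / r `<=` r'.
  by move=> W; have [rr'|r'r] := totC Cr Cr'; [|symmetry]; apply: W.
apply/seteqP; split=> //; apply: (contains_below_climb Cr' nj).
have ndr' := jumps_nondegenerate Cr' j'.
apply: nondegenerate_contains_below => //; [exact: CC|exact: CC| |by rewrite -NE].
apply: contrapT => nag.
have [s Cs [ags nags]] := j.
have ss' : s `<=` r'.
  have [//|r's] := totC Cs Cr'.
  by case: nag => x y xk yk xy; apply: ags => //; exact: r's.
apply: nags; apply: nondegenerate_contains_below => //; [exact: CC|exact: CC| |].
  by apply: contra_not ndr'; exact: degenerate_mono.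
by rewrite NE; exact: cong_nsub_mono.
Qed.

End UpperBound.

End Below.

(** * The lower bound *)

Section Layers.
Variables (S : semigroupType) (rk : S -> nat).
Hypothesis rk_ideal : forall x y, ideal x y -> (rk y <= rk x)%N.
Hypothesis rk_greenJ : forall x y, rk x = rk y -> greenJ x y.

Definition rees k : set (S * S) :=
  [set p | p.1 = p.2 \/ (rk p.1 < k)%N /\ (rk p.2 < k)%N].

Lemma rees_mono k l : (k <= l)%N -> rees k `<=` rees l.
Proof.
move=> kl p [e|[xk yk]]; first by left.
by right; split; exact: leq_trans kl.
Qed.

Lemma congI (r : set (S * S)) : equivalence_set r ->
  (forall s t x y, r (x, y) -> r (mulr (mull s x) t, mulr (mull s y) t)) -> Cong S r.
Proof.
move=> er rM; split=> // s x y xy.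
by split; [exact: (rM (Some s) None)|exact: (rM None (Some s))].
Qed.

Lemma rees_Cong k : Cong S (rees k).
Proof.
apply: congI; first split.
- by left.
- by move=> x y [/= ->|[]]; [left|right].
- move=> x y z [/= ->//|[/= xk yk]] [/= <-|[/= _ zk]]; by right.
- move=> s t x y [/= ->|[/= xk yk]]; first by left.
  by right; split; apply: leq_ltn_trans (rk_mul rk_ideal _ _ _) _.
Qed.

Section Layer.
Variables (a : S).
Local Notation G := (schutzenberger a).
Implicit Type N : set G.

Definition layer N : set (S * S) := rees (rk a) `|`
  [set p | [/\ rk p.1 = rk a, rk p.2 = rk a & nsub_rel N p.1 p.2]].

Lemma layer_Cong N : NSub G N -> Cong S (layer N).
Proof.
move=> NN; apply: congI; first split.
- by left; left.
- move=> x y [/(cong_sym (rees_Cong _))|[/= xa ya xy]]; first by left.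
  by right; split=> //; exact: nsub_rel_sym.
- move=> x y z [[/= ->//|[/= xa ya]]|[/= xa ya xy]].
    move=> [yz|[/= ya']]; last by rewrite ya' ltnn in ya.
    by left; apply: cong_trans yz; [exact: rees_Cong|right].
  move=> [[/= <-|[/=]]|[/= _ za yz]]; first by right.
    by rewrite ya ltnn.
  by right; split=> //; exact: nsub_rel_trans xy yz.
- move=> s t x y [xy|[/= xa ya xy]].
    by left; apply: cong_mul => //; exact: rees_Cong.
  have half u v : rk u = rk a -> rk v = rk a -> nsub_rel N u v ->
      rk (mulr (mull s u) t) = rk a -> rk (mulr (mull s v) t) = rk a.
    move=> ua va /(@nsub_rel_mul _ _ _ s t) uv sua.
    apply/eqP; rewrite eqn_leq -{1}va rk_mul//=.
    apply: rk_ideal; apply: nsub_rel_above uv _.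
    by have /greenJP[] := rk_greenJ sua.
  have [sxa|sxa] := eqVneq (rk (mulr (mull s x) t)) (rk a).
    by right; split=> //=; [exact: (half x y)|exact: nsub_rel_mul].
  left; right; rewrite !ltn_neqAle sxa /= -{1}xa -{2}ya !rk_mul //= andbT; split=> //.
  apply/negP => /eqP sya; move/eqP: sxa; apply.
  by apply: (half y x) => //; exact: nsub_rel_sym.
Qed.

Lemma layer_rees N : rees (rk a) `<=` layer N.
Proof. by move=> p; left. Qed.

Lemma layer_sub N : layer N `<=` rees (rk a).+1.
Proof.
move=> p [/(rees_mono (leqnSn _))//|[xa ya _]].
by right; rewrite xa ya.
Qed.

Lemma layer_mono N N' : N `<=` N' -> layer N `<=` layer N'.
Proof.
move=> NN' p [|[xa ya xy]]; first by left.
right; split=> // s t /(xy s t)[z [f Nf zf]].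
by exists z, f => //; exact: NN'.
Qed.

Hypothesis stS : stable S.

Let aH : hclass a := SigSub (mem_set (conj erefl erefl : hclass a a)).

Lemma rk_hclass (x : hclass a) : rk (val x) = rk a.
Proof. by symmetry; apply: greenJ_rk => //; apply: greenH_J; exact: set_valP. Qed.

Lemma layer_mem N f : NSub G N -> N f -> layer N (a, val (val f aH)).
Proof.
move=> NN Nf; right; split; rewrite //= ?rk_hclass//.
exact: (nsub_relP NN stS f aH).2.
Qed.

Lemma rees_mem (f : G) : rees (rk a) (a, val (val f aH)) -> f = 1%g.
Proof.
case=> [/= afa|[/=]]; last by rewrite ltnn.
by apply: (@translation_free _ _ _ _ aH); apply: val_inj; exact: esym afa.
Qed.

Lemma layer_inj N N' : NSub G N -> NSub G N' -> layer N `<=` layer N' -> N `<=` N'.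
Proof.
move=> NN NN' LL f Nf.
case: (LL _ (layer_mem NN Nf)) => [/rees_mem ->|[_ _]]; first by case: NN'.
by move/(nsub_relP NN' stS f aH).
Qed.

(** The layers of two consecutive J-classes share a congruence, the one that
    collapses the elements below the second class and nothing else.  Sending the
    trivial subgroup to the top of its layer makes all steps of a layer differ
    from this bottom. *)
Definition step N := if `[< N `<=` [set 1%g] >] then rees (rk a).+1 else layer N.

Lemma step_Cong N : NSub G N -> Cong S (step N).
Proof.
by move=> NN; rewrite /step; case: ifP => _; [exact: rees_Cong|exact: layer_Cong].
Qed.

Lemma step_sub N : step N `<=` rees (rk a).+1.
Proof. by rewrite /step; case: ifP => _ //; exact: layer_sub. Qed.

Lemma rees_step N : rees (rk a) `<=` step N.
Proof.
by rewrite /step; case: ifP => _; [exact: rees_mono|exact: layer_rees].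
Qed.

(* A point below the class of a distinguishes the top of the layer from all the
   congruences [layer N]. *)
Variable z : S.
Hypothesis za : (rk z < rk a)%N.

Let za_rees : rees (rk a).+1 (z, a).
Proof. by right; rewrite /= ltnS ltnW. Qed.

Let za_layer N : ~ layer N (z, a).
Proof.
case=> [[/= zE|[_ /=]]|[/= zE]]; first by move: za; rewrite zE ltnn.
  by rewrite ltnn.
by move: za; rewrite zE ltnn.
Qed.

Lemma step_nrees N : NSub G N -> ~ step N `<=` rees (rk a).
Proof.
move=> NN; rewrite /step; case: asboolP => [_ /(_ _ za_rees)|N1 LN].
  by move/(layer_rees set0)/za_layer.
by apply: N1 => f /(layer_mem NN)/LN/rees_mem.
Qed.

Lemma step_total N N' : N `<=` N' \/ N' `<=` N ->
  step N `<=` step N' \/ step N' `<=` step N.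
Proof.
rewrite /step; case: asboolP => [_|_]; case: asboolP => [_|_].
- by left.
- by right; exact: layer_sub.
- by left; exact: layer_sub.
- by case=> [/layer_mono|/layer_mono]; [left|right].
Qed.

Lemma step_inj N N' : NSub G N -> NSub G N' -> step N = step N' -> N = N'.
Proof.
move=> NN NN'; rewrite /step; case: asboolP => [N1|_]; case: asboolP => [N1'|_] e.
- by apply/seteqP; split=> [f /N1->|f /N1'->]; [case: NN'|case: NN].
- by case: (@za_layer N'); rewrite -e.
- by case: (@za_layer N); rewrite e.
- by apply/seteqP; split; apply: layer_inj => //; rewrite e.
Qed.

End Layer.

Section Minimal.
Variables (A : set S) (minA : jminimal A) (a0 : S) (Aa0 : A a0).
Local Notation B := (minimal_biact minA).

Lemma minimal_jclass : A = jclass a0.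
Proof.
have [[b _ AE] _] := minA; move: Aa0.
by rewrite -AE /jclass /greenJ /= => ->.
Qed.

(** Already a0 x is J-equivalent to a0, the minimal class being an ideal. *)
Lemma minimal_ideal x : ideal x a0.
Proof.
have : jclass a0 (a0 * x)%g by rewrite -minimal_jclass; exact: minimal_mulr.
case/greenJP => _ /idealP[s [t ->]]; apply/idealP; exists (mul1 s (Some a0)), t.
by rewrite -mull_mul1.
Qed.

Lemma minimal_rk x : A x -> rk x = rk a0.
Proof. by rewrite minimal_jclass => /(greenJ_rk rk_ideal). Qed.

Lemma rk_minimal x : (rk x <= rk a0)%N -> A x.
Proof.
move=> xa; rewrite minimal_jclass; apply: rk_greenJ; apply/eqP.
by rewrite eqn_leq xa andbT; apply: rk_ideal; exact: minimal_ideal.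
Qed.

Definition restrict (r : set (S * S)) : set (B * B) :=
  [set p | r (val p.1, val p.2)].

Lemma restrict_Cong r : Cong S r -> biact_Cong B (restrict r).
Proof.
move=> Cr; split; first split.
- by move=> x; exact: cong_refl.
- by move=> x y; exact: cong_sym.
- by move=> x y w; exact: cong_trans.
- move=> s x y xy; split; first exact: (cong_mul Cr (Some s) None).
  exact: (cong_mul Cr None (Some s)).
Qed.

Lemma restrict_contains_below r r' : restrict r = restrict r' ->
  contains_below rk (rk a0).+1 r r'.
Proof.
move=> e x y /rk_minimal/mem_set Ax /rk_minimal/mem_set Ay xy.
have : restrict r' (SigSub Ax : B, SigSub Ay : B) by [].
by rewrite -e.
Qed.

Definition extend (q : set (B * B)) : set (S * S) :=
  [set p | p.1 = p.2 \/ exists2 u : B * B, q u & p = (val u.1, val u.2)].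

Lemma extend_Cong q : biact_Cong B q -> Cong S (extend q).
Proof.
move=> [[qr qs qt] qM]; split; first split.
- by left.
- move=> x y [/= ->|[[u v] uv [-> ->]]]; first by left.
  by right; exists (v, u) => //; exact: qs.
- move=> x y w [/= ->//|[[u v] uv [-> yE]]] [/= <-|[[u' v'] uv' [yE' ->]]].
    by right; exists (u, v); rewrite //= -yE.
  right; exists (u, v') => //; apply: qt uv _.
  by rewrite (_ : v = u') //; apply: val_inj; rewrite /= -yE.
- move=> s x y [/= ->|[[u v] uv [-> ->]]]; first by split; left.
  have [suv uvs] := qM s _ _ uv.
  by split; right; [exists (lact s u, lact s v)|exists (ract u s, ract v s)].
Qed.

Lemma restrict_extend q : biact_Cong B q -> restrict (extend q) = q.
Proof.
move=> [[qr _ _] _]; apply/seteqP; split=> [[x y] [/= /val_inj->//|]|[x y] xy].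
  by move=> [[u v] uv [/val_inj -> /val_inj ->]].
by right; exists (x, y).
Qed.

Lemma extend_mono q q' : q `<=` q' -> extend q `<=` extend q'.
Proof.
move=> qq' p [e|[u uv e]]; first by left.
by right; exists u => //; exact: qq'.
Qed.

Lemma extend_sub q : extend q `<=` rees (rk a0).+1.
Proof.
move=> p [e|[u _ ->]]; first by left.
by right; rewrite /= !ltnS !minimal_rk //; exact: set_valP.
Qed.

Section LowerBound.
Hypothesis stS : stable S.
Variables (n : nat) (a : 'I_n -> S).
Hypothesis a0_lt : forall i, (rk a0 < rk (a i))%N.
Hypothesis rk_inj : injective (rk \o a).
Variables (C0 : set (set (B * B))) (C : forall i, set (set (schutzenberger (a i)))).
Hypothesis chainB : chain (biact_Cong B) C0.
Hypothesis chainC : forall i, chain (NSub (schutzenberger (a i))) (@C i).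

Let U : Type := (C0 + {i & @C i})%type.

Let F (u : U) : set (S * S) :=
  match u with
  | inl q => extend (val q)
  | inr (existT i N) => step (val N)
  end.

Let lev (u : U) : nat :=
  match u with inl _ => rk a0 | inr (existT i _) => rk (a i) end.

Let C0C (q : C0) : biact_Cong B (val q).
Proof. by case: chainB => + _; apply; exact: set_valP. Qed.

Let CN i (N : @C i) : NSub _ (val N).
Proof. by case: (chainC i) => + _; apply; exact: set_valP. Qed.

Let F_Cong u : Cong S (F u).
Proof.
case: u => [q|[i N]]; first exact: extend_Cong (C0C q).
exact: step_Cong (CN N).
Qed.

Let F_lt u v : (lev u < lev v)%N -> F u `<=` F v /\ F u <> F v.
Proof.
move=> uv; have Fu : F u `<=` rees (lev u).+1.
  by case: u {uv} => [q|[i N]]; [exact: extend_sub|exact: step_sub].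
have {}Fu : F u `<=` rees (lev v) by apply: subset_trans Fu _; exact: rees_mono.
case: v uv Fu => [q|[i N]] uv Fu.
  case: u uv Fu => [q'|[i N]] /=; first by rewrite ltnn.
  by rewrite ltnNge ltnW.
split; first exact: subset_trans Fu (@rees_step _ _).
move=> FE; apply: (step_nrees stS (a0_lt i) (CN N)).
by rewrite -/(F (inr (existT _ i N))) -FE.
Qed.

Let F_eqlev u v : lev u = lev v ->
  (F u `<=` F v \/ F v `<=` F u) /\ (F u = F v -> u = v).
Proof.
case: u v => [q|[i N]] [q'|[j N']] /=.
- move=> _; split.
    case: chainB => _ /(_ _ _ (set_valP q) (set_valP q')).
    by case=> /subsetPset/extend_mono; [left|right].
  move=> e; congr inl; apply: val_inj.
  by rewrite -[LHS](restrict_extend (C0C q)) e (restrict_extend (C0C q')).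
- by move=> e; have := a0_lt j; rewrite -e ltnn.
- by move=> e; have := a0_lt i; rewrite e ltnn.
move/rk_inj => ij; case: _ / ij N' => N'; split.
  apply: step_total.
  case: (chainC i) => _ /(_ _ _ (set_valP N) (set_valP N')).
  by case=> /subsetPset; [left|right].
move=> e; congr (inr (existT _ _ _)); apply: val_inj.
exact: (step_inj stS (a0_lt i) (CN N) (CN N') e).
Qed.

(** The image of F is a chain: everything at one level lies strictly below
    everything at a later level, and inside a level comparable data give
    comparable congruences. *)
Lemma chain_card_ge : [set: U] #<= height (Cong S).
Proof.
have injF : injective F.
  move=> u v e; have [uv|vu|uv] := ltngtP (lev u) (lev v).
  - by case: (F_lt uv).
  - by case: (F_lt vu) => _; rewrite e.
  - exact: (F_eqlev uv).2.
have chF : chain (Cong S) (range F).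
  split=> [_ [u _ <-]|_ _ [u _ <-] [v _ <-]]; first exact: F_Cong.
  suff : F u `<=` F v \/ F v `<=` F u by case=> /subsetPset; [left|right].
  have [uv|vu|uv] := ltngtP (lev u) (lev v).
  - by left; case: (F_lt uv).
  - by right; case: (F_lt vu).
  - exact: (F_eqlev uv).1.
apply: card_le_trans (height_bound chF).
by rewrite (card_le_eqr (inj_card_eq (in2W injF))) card_lexx.
Qed.

End LowerBound.

End Minimal.
End Layers.

Theorem theorem9p10 (S : semigroupType) (n : nat) (J : 'I_n.+1 -> set S)
    (a : 'I_n.+1 -> S) :
  stable S ->
  set_bij [set: 'I_n.+1] jclasses J ->
  forall J1_minimal : jminimal (J ord0),
  (forall r, J r (a r)) ->
  (forall r : 'I_n, hseparable (J (lift ord0 r))) ->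
  height (Cong S) #=
  [set: (height (biact_Cong (minimal_biact J1_minimal)) +
         {r : 'I_n & height (NSub (schutzenberger (a (lift ord0 r))))})%type].
Proof.
move=> stS bijJ minJ Ja sepJ.
have [rk [rk_ideal rk_greenJ rk_bound]] := jrank_ex bijJ.
have JE r : J r = jclass (a r) := J_jclass bijJ (Ja r).
have a_inj r s : rk (a r) = rk (a s) -> r = s.
  move=> /rk_greenJ rs; apply: (J_inj bijJ).
  by rewrite !JE /jclass /greenJ rs.
have a0_lt r : (rk (a ord0) < rk (a (lift ord0 r)))%N.
  rewrite ltn_neqAle; apply/andP; split.
    by apply/eqP => /a_inj/eqP; rewrite (negPf (neq_lift _ _)).
  by apply: rk_ideal; exact: (minimal_ideal minJ (Ja ord0)).
apply/card_eqPle; split.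
- apply: height_least => C CS.
  have rk_cover x : (rk (a ord0) < rk x)%N -> exists r, rk x = rk (a (lift ord0 r)).
    have [s sx] := jclass_index bijJ x.
    have -> : rk x = rk (a s).
      have : jclass x (a s) by rewrite -sx.
      exact: greenJ_rk.
    have [r ->|->] := unliftP ord0 s; first by exists r.
    by rewrite ltnn.
  have sepa r : hseparable (jclass (a (lift ord0 r))) by rewrite -JE; exact: sepJ.
  apply: card_le_trans
    (chain_card_le stS rk_ideal rk_greenJ CS rk_bound rk_cover sepa _) _.
    by move=> r r' _ _; exact: (restrict_contains_below rk_ideal rk_greenJ (Ja ord0)).
  case: CS => CS totC; apply: sum_card_le => [|r]; apply: height_bound.
    split=> [_ [r Cr <-]|_ _ [r Cr <-] [r' Cr' <-]].
      by apply: restrict_Cong; exact: CS.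
    by case: (totC r r' Cr Cr') => /subsetPset rr'; [left|right];
      apply/subsetPset => p; exact: rr'.
  split=> [_ [s Cs <-]|_ _ [s Cs <-] [s' Cs' <-]].
    by apply: cong_nsub_NSub; exact: CS.
  by case: (totC s s' Cs Cs') => /subsetPset rr'; [left|right];
    apply/subsetPset; exact: cong_nsub_mono.
- apply: height_sum_le => C0 C C0P CP.
  apply: (chain_card_ge rk_ideal rk_greenJ (Ja ord0) stS a0_lt _ C0P CP).
  by move=> r s /a_inj/lift_inj.
Qed.
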